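(* Let $H:\mathbb{R}^n\to\mathbb{R}^n$ be a polynomial map whose Jacobian matrix $JH$ is nilpotent, and let $\lambda\in\mathbb{R}\setminus\{0\}$. Assume that $X+\lambda^{-1}H$ is invertible, with inverse written as $G=X+\overline{H}$, and put $\widetilde{H}:=\lambda\,\overline{H}(\lambda^{-1}X)$, so that the inverse of $F_\lambda:=\lambda X+H$ is $F_\lambda^{-1}=\lambda^{-1}(X+\widetilde{H})$. Then: (i) $J\widetilde{H}$ is nilpotent. (ii) If the rows of $JH$ are linearly independent over $\mathbb{R}$, then the rows of $J\widetilde{H}$ are linearly independent over $\mathbb{R}$.
   Context: $X$ denotes the identity map of $\mathbb{R}^n$, and $\overline{H}(\lambda^{-1}X)$ denotes the map $x\mapsto\overline{H}(\lambda^{-1}x)$. $JH$ nilpotent means $(JH)^{d+1}=0$ identically for some $d$. The rows of a Jacobian matrix (a matrix of functions) are linearly independent over $\mathbb{R}$ if no nontrivial linear combination of them with constant real coefficients vanishes identically. *)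

(* Defs.v *)
From HB Require Import structures.
From mathcomp Require Import all_boot all_order all_algebra.
From mathcomp Require Import all_classical all_reals all_analysis.
(* The notations of mpoly clash with those of MathComp-Analysis. *)
From mathcomp Require mpoly.
Import -(notations) mpoly.

Set Implicit Arguments.
Unset Strict Implicit.
Unset Printing Implicit Defensive.

Import Order.TTheory GRing.Theory Num.Theory.
Import numFieldNormedType.Exports.

Local Open Scope ring_scope.

(* Points of R^n are row vectors. *)
Definition polynomial_map (R : realType) (n : nat)
    (F : 'rV[R]_n -> 'rV[R]_n) : Prop :=
  exists p : 'I_n -> mpoly n R, forall (x : 'rV[R]_n) (i : 'I_n),
    F x 0 i = meval (fun j => x 0 j) (p i).

(* The library's 'J acts on row vectors from the right, so its (i, j) entry is
   the derivative of F_j along the i-th coordinate; the transpose is the usual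
   matrix whose i-th row is the gradient of F_i. *)
Definition Jac (R : realType) (n : nat) (F : 'rV[R]_n -> 'rV[R]_n)
    (x : 'rV[R]_n) : 'M[R]_n := (jacobian F x)^T.

Definition nilpotent_mxfun (R : realType) (n : nat)
    (A : 'rV[R]_n -> 'M[R]_n) : Prop :=
  exists d : nat, forall x, A x ^+ d.+1 = 0.

(* c *m A x is the combination of the rows of A x with constant coefficients c,
   the same for all x. *)
Definition rows_independent (R : realType) (n : nat)
    (A : 'rV[R]_n -> 'M[R]_n) : Prop :=
  forall c : 'rV[R]_n, (forall x, c *m A x = 0) -> c = 0.

(* Main.v *)
(* With M = lambda^-1 JH at G y, the inverse G of F = X + lambda^-1 H has Jacobian
   (1 + M)^-1 at y, so that J Htilde = (1 + M)^-1 - 1 at lambda y.  This equals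
   - M (1 + M)^-1, a product of commuting factors with M nilpotent, and
   c J Htilde = 0 forces c M = 0.

   G is only given as a set-theoretic inverse, and its differentiability needs an
   inverse function theorem.  As F is a bijection, continuity of G at y0 is easy:
   |F x - y0|^2 is bounded below on a sphere around G y0, so for y near y0 the
   minimum of |F x - y|^2 over the closed ball is attained in the interior, where
   criticality and the invertibility of dF give F x = y, i.e. x = G y lies in the
   ball. *)
Require Import Defs.
From HB Require Import structures.
From mathcomp Require Import all_boot all_order all_algebra.
From mathcomp Require Import all_classical all_reals all_analysis.
From mathcomp Require mpoly.
From mathcomp Require Import ring lra.
Import -(notations) mpoly.
Set Implicit Arguments.
Unset Strict Implicit.
Unset Printing Implicit Defensive.
Import Order.TTheory GRing.Theory Num.Theory.
Import numFieldNormedType.Exports.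
Local Open Scope ring_scope.

(** * Differentiability of polynomial maps *)

Lemma differentiable_rV (R : numFieldType) (V : normedModType R) n
    (f : V -> 'rV[R]_n) x :
  (forall i, differentiable (fun x => f x 0 i) x) -> differentiable f x.
Proof.
move=> df.
rewrite (_ : f = \sum_(i < n) (fun x => f x 0 i *: delta_mx 0 i)).
  by apply: differentiable_sum => i; exact: differentiableZl.
by apply/funext => y; rewrite fct_sumE [LHS]row_sum_delta.
Qed.

Lemma differentiable_meval (R : realType) n (p : mpoly n R) x :
  differentiable (fun x : 'rV[R]_n => meval (fun j => x 0 j) p) x.
Proof.
elim/mpolyind: p => [|c m p _ _ dp].
  rewrite (_ : (fun _ => _) = cst 0); first exact: differentiable_cst.
  by apply/funext => y; rewrite meval0.
rewrite (_ : (fun _ => _) = c *: (fun y : 'rV[R]_n =>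
  \prod_(i < n) y 0 i ^+ m i) + (fun y => meval (fun j => y 0 j) p)); last first.
  by apply/funext => y; rewrite mevalD mevalZ mevalX.
apply: differentiableD => //; apply: differentiableZ.
rewrite (_ : (fun _ => _) = \prod_(i < n) (fun y : 'rV[R]_n => y 0 i) ^+ m i); last first.
  by apply/funext => y; rewrite fct_prodE; apply: eq_bigr => i _; rewrite fctE.

elim/big_rec: _ => [|i f _ df]; first exact: differentiable_cst.
apply: differentiableM => //.
case: (m i) => [|k]; first exact: differentiable_cst.
by apply: differentiableX; exact: differentiable_coord.
Qed.

Lemma polynomial_map_differentiable (R : realType) n (F : 'rV[R]_n -> 'rV[R]_n) x :
  polynomial_map F -> differentiable F x.
Proof.
move=> [p Fp]; apply: differentiable_rV => i.
rewrite (_ : (fun _ => _) = fun y : 'rV[R]_n => meval (fun j => y 0 j) (p i)).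
  exact: differentiable_meval.
by apply/funext => y.
Qed.

(** * The squared Euclidean norm and critical points *)

(* The norm of 'rV[R]_n is the sup norm, which is not differentiable. *)
Definition sqnorm (R : realType) n (v : 'rV[R]_n) : R := \sum_(i < n) v 0 i ^+ 2.

Lemma sqnorm_ge0 (R : realType) n (v : 'rV[R]_n) : 0 <= sqnorm v.
Proof. by apply: sumr_ge0 => i _; exact: sqr_ge0. Qed.

Lemma sqnorm_eq0 (R : realType) n (v : 'rV[R]_n) : sqnorm v = 0 -> v = 0.
Proof.
move=> /psumr_eq0P v0; apply/rowP => i; rewrite mxE.
by apply/eqP; rewrite -sqrf_eq0 v0 // => j _; exact: sqr_ge0.
Qed.

(** Coordinatewise, [2ab <= a^2 + b^2]. This stands in for the triangle inequality, which fails for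
    a squared norm. *)
Lemma sqnormD (R : realType) n (u v : 'rV[R]_n) :
  sqnorm (u + v) <= 2 * (sqnorm u + sqnorm v).
Proof.
rewrite /sqnorm -big_split mulr_sumr; apply: ler_sum => i _; rewrite mxE /=.
by have := sqr_ge0 (u 0 i - v 0 i); nra.
Qed.

Lemma sqnormE (R : realType) n : @sqnorm R n = \sum_(i < n) (fun v : 'rV[R]_n => v 0 i) ^+ 2.
Proof. by apply/funext => v; rewrite fct_sumE; apply: eq_bigr. Qed.

Lemma differentiable_sqnorm (R : realType) n (v : 'rV[R]_n) :
  differentiable (@sqnorm R n) v.
Proof.
rewrite sqnormE; apply: differentiable_sum => i; apply: differentiableX.
exact: differentiable_coord.
Qed.

Lemma diff_sqnorm (R : realType) n (v u : 'rV[R]_n) :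
  'd (@sqnorm R n) v u = \sum_(i < n) 2 * v 0 i * u 0 i.
Proof.
have dc i : differentiable (fun w : 'rV[R]_n => w 0 i) v := differentiable_coord v 0 i.
rewrite -deriveE; last exact: differentiable_sqnorm.
rewrite sqnormE derive_sum => [|i].
  apply: eq_bigr => i _; rewrite deriveX ?expr1; last exact: diff_derivable.
  congr (_ * _); rewrite -[in RHS](derive_id v u) derive_mx ?mxE//.
apply/derivableX/diff_derivable; exact: dc.
Qed.

(** Fermat's rule on a line: the one-variable function [g t = f (t *: v + c)] has a local minimum at
    0, and its derivative there is that of [f] at [c] along [v]. *)
Lemma local_min_derive0 (R : realType) (V : normedModType R) (f : V -> R) c e v :
  0 < e -> (forall x, differentiable f x) ->
  (forall x, `|x - c| < e -> f c <= f x) -> 'd f c v = 0.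
Proof.
(* The [+ 1] in [r] covers [v = 0]; for [|t| < r] the point [t *: v + c] stays within [e] of [c]. *)
move=> e0 df fmin; pose g (t : R) := f (t *: v + c); pose r : R := e / (`|v| + 1).
have v1 : 0 < `|v| + 1 by rewrite ltr_wpDl.
have r0 : 0 < r by rewrite divr_gt0.
have [_] : is_derive (0 : R) (1 : R) g 0.
  apply: (@derive1_at_min _ g (- r) r).
  - lra.
  - move=> t _; apply/derivable1_diffP.
    apply: (@differentiable_comp _ _ _ _ (fun s : R => s *: v + c) f) => //.
  - by rewrite in_itv /= oppr_lt0 r0.
  - move=> t; rewrite in_itv /= => /andP[rt tr]; rewrite /g scale0r add0r.
    apply: fmin; rewrite addrK normrZ.
    have : `|t| < r by rewrite ltr_norml rt.
    rewrite ltr_pdivlMr //; apply: le_lt_trans.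
    by rewrite ler_wpM2l // lerDl.
rewrite -deriveE // => <-; rewrite /derive.
set p := (X in lim (X @ _)%classic = _); set q := (X in _ = lim (X @ _)%classic).
suff -> : p = q by [].
by apply/funext => h; rewrite /p /q /= /g scale0r add0r [h%:A]mulr1 addr0.
Qed.

(** By the choice of [u], the derivative of [sqnorm (F x - y)] at [c] along [u] is
    [2 * sqnorm (F c - y)], and it vanishes at a minimum. *)
Lemma local_min_sqnorm (R : realType) n (F : 'rV[R]_n -> 'rV[R]_n) c y e :
  0 < e -> (forall x, differentiable F x) ->
  (exists u, 'd F c u = F c - y) ->
  (forall x, `|x - c| < e -> sqnorm (F c - y) <= sqnorm (F x - y)) -> F c = y.
Proof.
move=> e0 dF [u uE] minc.
have dFy x : differentiable (F - cst y) x by exact: differentiableB.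
have dE : 'd (F - cst y) c u = F c - y.
  rewrite -deriveE // deriveB; [|exact: diff_derivable..].
  by rewrite derive_cst subr0 deriveE.
have := @local_min_derive0 _ _ (@sqnorm R n \o (F - cst y)) c e u e0.
rewrite diff_comp //; last exact: differentiable_sqnorm.
rewrite /= dE diff_sqnorm => H.
apply/eqP; rewrite -subr_eq0; apply/eqP/sqnorm_eq0.
have {H} : \sum_(i < n) 2 * (F c - y) 0 i * (F c - y) 0 i = 0.
  by apply: H => // x; apply: differentiable_comp => //; exact: differentiable_sqnorm.
under eq_bigr do rewrite -mulrA -expr2.
by rewrite -mulr_sumr -/(sqnorm _); lra.
Qed.

(** * Continuity of the inverse map *)

Lemma closed_ball_compact (R : realType) n (c : 'rV[R]_n) r :
  0 < r -> compact [set x | `|c - x| <= r]%classic.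
Proof.
move=> r0; rewrite (_ : mkset _ = closed_ball c r); last by rewrite closed_ballE.
apply: bounded_closed_compact; last exact: closed_ball_closed.
exists (`|c| + r); split; first exact: num_real.
move=> M cM x; rewrite /= closed_ballE // /closed_ball_ /= => cx.
apply: ltW; apply: le_lt_trans cM; rewrite addrC -lerBlDr.
by apply: le_trans cx; rewrite distrC; exact: lerB_dist.
Qed.

Lemma sphere_compact (R : realType) n (c : 'rV[R]_n) r :
  0 < r -> compact [set x | `|c - x| = r]%classic.
Proof.
move=> r0; have sub : ([set x | `|c - x| = r] `<=` [set x | `|c - x| <= r])%classic.
  by move=> x /= ->.
apply: subclosed_compact (closed_ball_compact r0) sub.
have cf : continuous (fun x : 'rV[R]_n => `|c - x|).
  have cc : continuous (fun x : 'rV[R]_n => c - x).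
    by move=> x; apply: differentiable_continuous; exact: differentiableB.
  by move=> x; exact: cvg_norm (cc x).
exact: (closed_comp (fun x _ => cf x) (@closed_eq _ r)).
Qed.

Lemma inverse_continuous (R : realType) n (F G : 'rV[R]_n -> 'rV[R]_n) :
  (forall x, differentiable F x) -> (forall x v, exists u, 'd F x u = v) ->
  cancel F G -> cancel G F -> continuous G.
Proof.
move=> dF Fsurj FK GK y0; set x0 := G y0.
have cF y : continuous (fun x => sqnorm (F x - y)).
  move=> x; have df : differentiable (@sqnorm R n \o (F - cst y)) x.
    apply: differentiable_comp; first exact: differentiableB.
    exact: differentiable_sqnorm.
  exact: differentiable_continuous df.
have cvgP := @cvgrPdist_lt R 'rV[R]_n 'rV[R]_n (nbhs y0) _ G (G y0).
apply/cvgP => e e0 {cvgP}.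
have [m m0 Sm] : exists2 m, 0 < m & forall x, `|x0 - x| = e -> m <= sqnorm (F x - y0).
  have [S0|/set0P/negP/negPn/eqP S0] := pselect ([set x | `|x0 - x| = e] !=set0)%classic.
    have [c] := EVT_min_rV S0 (@sphere_compact R n x0 e e0) (continuous_subspaceT (cF y0)).
    rewrite inE /= => ce cmin; exists (sqnorm (F c - y0)); last first.
      by move=> x xe; apply: cmin; rewrite inE.
    rewrite lt_neqAle sqnorm_ge0 andbT eq_sym; apply/eqP => /sqnorm_eq0/eqP.
    rewrite subr_eq0 => /eqP Fc; move: ce; rewrite /x0 -Fc FK subrr normr0 => e00.
    by rewrite e00 ltxx in e0.
  (* An empty sphere occurs only in dimension 0; any positive bound will do. *)
  exists 1 => // x xe; have : [set x | `|x0 - x| = e]%classic x by [].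
  by rewrite S0.
(* With [m / 4], a minimiser [c] on the sphere would give [sqnorm (F c - y0) < 2 * (m / 4 + m / 4) =
   m] by [sqnormD], against the choice of [m]. *)
have : \forall y \near y0, sqnorm (y0 - y) < m / 4.
  have c0 : continuous (fun y : 'rV[R]_n => sqnorm (y0 - y)).
    move=> y; have df : differentiable (@sqnorm R n \o (cst y0 - id)) y.
      apply: differentiable_comp; first exact: differentiableB.
      exact: differentiable_sqnorm.
    exact: differentiable_continuous df.
  apply: (cvgr_lt _ (c0 y0)); rewrite subrr /sqnorm big1 ?divr_gt0 // => i _.
  by rewrite mxE expr0n.
apply: filterS => y yy0.
have Bn : ([set x | `|x0 - x| <= e] !=set0)%classic.
  by exists x0; rewrite /= subrr normr0 ltW.
have [c] := EVT_min_rV Bn (@closed_ball_compact R n x0 e e0) (continuous_subspaceT (cF y)).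
rewrite inE /= => ce cmin.
have Fx0 : F x0 = y0 by rewrite /x0 GK.
have cx0 : sqnorm (F c - y) < m / 4.
  by apply: le_lt_trans yy0; rewrite -Fx0; apply: cmin; rewrite inE /= subrr normr0 ltW.
have {}ce : `|x0 - c| < e.
  rewrite lt_neqAle ce andbT; apply/eqP => /Sm.
  have := sqnormD (F c - y) (y - y0); rewrite addrA subrK.
  have -> : sqnorm (y - y0) = sqnorm (y0 - y).
    by apply: eq_bigr => i _; rewrite !mxE -sqrrN opprB.
  by lra.
suff Fc : F c = y by rewrite -Fc FK.
(* The ball of this radius around [c] lies in the ball on which [c] is minimal. *)
apply: (@local_min_sqnorm _ _ F c y (e - `|x0 - c|)); rewrite ?subr_gt0 //.
move=> x xc; apply: cmin; rewrite inE /=.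
rewrite -(subrK c x0) -addrA; apply: le_trans (ler_normD _ _) _.
by rewrite (distrC c x); lra.
Qed.

(** * Differentiability of the inverse map *)

Lemma mulmxr_continuous (R : realType) m n (A : 'M[R]_(m, n)) :
  continuous (mulmxr A : 'rV[R]_m -> 'rV[R]_n).
Proof.
move=> x; apply: differentiable_continuous; apply: differentiable_rV => i.
rewrite (_ : (fun _ => _) = \sum_(j < m) A j i *: (fun y : 'rV[R]_m => y 0 j)).
  by apply: differentiable_sum => j; apply/differentiableZ/differentiable_coord.
apply/funext => y; rewrite fct_sumE mxE; apply: eq_bigr => j _.
by rewrite mulrC.
Qed.

(** Unfolds the little-o of the differential into explicit bounds, so that the estimate for [F] can
    be pulled back along the continuous [G]. The converse uses uniqueness of the differential. *)
Lemma diff_approxP (R : realFieldType) (V W : normedModType R) (f : V -> W)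
    (df : {linear V -> W}) x : continuous df ->
  (differentiable f x /\ 'd f x = df :> (V -> W)) <->
  (forall e, 0 < e ->
    \forall y \near x, `|f y - (f x + df (y - x))| <= e * `|y - x|).
Proof.
move=> cdf; split=> [[dfx <-] e e0|approx].
  have /eqaddoP/(_ e e0) dfo := diff_locally dfx.
  rewrite (near_shift 0) subr0; apply: filterS dfo => h /=.
  by rewrite addrK.
have E : f \o shift x = cst (f x) + df +o_ (0 : V) id.
  apply/eqaddoP => e /approx; rewrite (near_shift 0) subr0; apply: filterS => h /=.
  by rewrite addrK.
have dfE := diff_unique cdf E.
by split=> //; apply/diff_locallyP; rewrite dfE; split.
Qed.

(** Put [h = G y - G y0] and [k = y - y0]. As [F (G y) = y], the expansion of [F] reads
    [k = h *m A + r] with [r] small against [h], so [h - k *m invmx A = - (r *m invmx A)]. It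
    remains to bound [h] by [k]. *)
Lemma inverse_diff (R : realType) n (F G : 'rV[R]_n -> 'rV[R]_n) y0 :
  differentiable F (G y0) -> 'J F (G y0) \in unitmx ->
  {for y0, continuous G} -> cancel G F ->
  differentiable G y0 /\ 'J G y0 = invmx ('J F (G y0)).
Proof.
move=> dF uA cG GK; set A := 'J F (G y0) in uA *.
have cA := @mulmxr_continuous R n n (invmx A).
have [C C0 leC] := linear_lipschitz cA.
suff [dG dGE] : differentiable G y0 /\
    'd G y0 = mulmxr (invmx A) :> ('rV[R]_n -> 'rV[R]_n).
  split=> //; apply/row_matrixP => i.
  by rewrite !rowE mul_rV_lin1 dGE.
apply/(diff_approxP _ _ cA) => e e0.
(* The first bound absorbs [C * d * |h|] into [|h|] and yields [|h| <= 2 * C * |k|]; by the second,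
   the error [C * d * |h|] is then at most [e * |k|]. *)
have [d [d0 dC dCe]] : exists d, [/\ 0 < d, d * (2 * C) <= 1 & d * (2 * C ^+ 2) <= e].
  exists (Num.min (2 * C)^-1 (e / (2 * C ^+ 2))); split.
  - by rewrite lt_min invr_gt0 divr_gt0 // !mulr_gt0 ?exprn_gt0.
  - by rewrite -ler_pdivlMr ?mulr_gt0 // div1r ge_min lexx.
  - by rewrite -ler_pdivlMr ?mulr_gt0 ?exprn_gt0 // ge_min lexx orbT.
have [/(_ _ d d0) Fo _] := diff_approxP F (G y0) (diff_continuous dF).
have {}Fo := Fo (conj dF erefl).
have GFo : \forall y \near y0,
    `|F (G y) - (F (G y0) + 'd F (G y0) (G y - G y0))| <= d * `|G y - G y0|.
  exact: cG _ Fo.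
apply: filterS GFo => y; rewrite !GK; set h := G y - G y0.

have -> : 'd F (G y0) h = h *m A by rewrite mul_rV_lin1.
set r := (X in `|X|) => rh.
set k := y - y0 in r rh *.
have hE : h - k *m invmx A = - (r *m invmx A).
  by rewrite /r opprD addrA -/k [in RHS]mulmxBl mulmxK // opprB.
have hk : `|h - k *m invmx A| <= C * d * `|h|.
  rewrite hE normrN -mulrA; apply: le_trans (leC _) _.
  by rewrite ler_pM2l.
have hle : `|h| <= C * `|k| + C * d * `|h|.
  rewrite -{1}(subrK (k *m invmx A) h) addrC; apply: le_trans (ler_normD _ _) _.
  by rewrite lerD // leC.
rewrite /= -[X in `|X|]/(G y - (G y0 + (y - y0) *m invmx A)) opprD addrA -/h.
apply: le_trans hk _.
have hk2 : `|h| <= 2 * C * `|k|.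
  by have := ler_wpM2r (normr_ge0 h) dC; lra.
apply: (@le_trans _ _ (C * d * (2 * C * `|k|))).
  by rewrite ler_pM2l // mulr_gt0.
have -> : C * d * (2 * C * `|k|) = d * (2 * C ^+ 2) * `|k| by ring.
exact: ler_wpM2r.
Qed.

(** * Nilpotent perturbations of the identity matrix *)

Lemma nilpotent_scale (R : comPzRingType) n (A : 'M[R]_n) c k :
  A ^+ k = 0 -> (c *: A) ^+ k = 0.
Proof.
move=> Ak0; rewrite -mul_scalar_mx mulmxE exprMn_comm ?Ak0 ?mulr0 //.
by rewrite /GRing.comm -!mulmxE scalar_mxC.
Qed.

(** [1 + A] times the finite geometric sum of the powers of [- A] is [1 - (- A) ^+ k = 1]. *)
Lemma nilpotent_add1_unit (R : comUnitRingType) n (A : 'M[R]_n) k :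
  A ^+ k = 0 -> 1%:M + A \in unitmx.
Proof.
move=> Ak0; have := subrX1 (- A) k.
rewrite -scaleN1r (nilpotent_scale _ Ak0) scaleN1r sub0r -opprD mulNr.
move=> /oppr_inj /esym; rewrite addrC -mulmxE => /mulmx1_unit[].
by [].
Qed.

Lemma inv_add1_sub1_mul (R : comUnitRingType) n (A : 'M[R]_n) :
  1%:M + A \in unitmx -> (invmx (1%:M + A) - 1%:M) *m (1%:M + A) = - A.
Proof. by move=> uA; rewrite mulmxBl mulVmx // mul1mx opprD addrA subrr add0r. Qed.

(** [B = invmx U - 1] commutes with [U = 1 + A] and [B * U = - A], so
    [B ^+ k * U ^+ k = (- A) ^+ k = 0]; the invertible factor cancels. *)
Lemma inv_add1_sub1_nilpotent (R : comUnitRingType) n (A : 'M[R]_n) k :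
  A ^+ k = 0 -> (invmx (1%:M + A) - 1%:M) ^+ k = 0.
Proof.
move=> Ak0; have uA := nilpotent_add1_unit Ak0.
set U := 1%:M + A in uA *; set B := invmx U - 1%:M.
have UV : GRing.comm U (invmx U) by rewrite /GRing.comm -!mulmxE mulmxV ?mulVmx.
have BU : GRing.comm B U by apply/commr_sym/commrB => //; exact: commr1.
have : B ^+ k * U ^+ k = 0.
  rewrite -exprMn_comm // -mulmxE inv_add1_sub1_mul // -scaleN1r.
  exact: nilpotent_scale.
move=> /(congr1 ( *%R^~ (invmx U ^+ k))); rewrite mul0r -mulrA -exprMn_comm //.
have -> : U * invmx U = 1 by rewrite -mulmxE mulmxV.
by rewrite expr1n mulr1.
Qed.

(** * The Jacobian of [Htilde] and the conclusion *)

Lemma jacobian_eq (R : realType) m n (f : 'rV[R]_m -> 'rV[R]_n) x (A : 'M[R]_(m, n)) :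
  differentiable f x -> (forall v, 'D_v f x = v *m A) -> 'J f x = A.
Proof.
by move=> df DA; apply/row_matrixP => i; rewrite !rowE -deriveEjacobian // DA.
Qed.

Theorem theorem3 (R : realType) (n : nat) (H : 'rV[R]_n -> 'rV[R]_n)
    (lambda : R) (G : 'rV[R]_n -> 'rV[R]_n)
    (H_poly : polynomial_map H)
    (JH_nilp : nilpotent_mxfun (Jac H))
    (lambda_neq0 : lambda != 0)
    (GK : cancel (fun x => x + lambda^-1 *: H x) G)
    (KG : cancel G (fun x => x + lambda^-1 *: H x)) :
  let Hbar := fun x : 'rV[R]_n => G x - x in
  let Htilde := fun x : 'rV[R]_n => lambda *: Hbar (lambda^-1 *: x) in
  let Flambda := fun x : 'rV[R]_n => lambda *: x + H x in
  let Flambda_inv := fun x : 'rV[R]_n => lambda^-1 *: (x + Htilde x) in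
  [/\ cancel Flambda Flambda_inv /\ cancel Flambda_inv Flambda,
      forall x, differentiable Htilde x,
      nilpotent_mxfun (Jac Htilde)
    & rows_independent (Jac H) -> rows_independent (Jac Htilde)].
Proof.
move=> Hbar Htilde Flambda Flambda_inv.
set F := (fun x => x + lambda^-1 *: H x) in GK KG.
have dH x : differentiable H x by exact: polynomial_map_differentiable.
have dF x : differentiable F x.
  by apply: (@differentiableD _ _ _ id (lambda^-1 *: H)) => //; exact: differentiableZ.
have [d Jd0] := JH_nilp.
pose M x := lambda^-1 *: Jac H x.
have M0 x : M x ^+ d.+1 = 0 by exact: nilpotent_scale.
have uM x : 1%:M + M x \in unitmx by exact: nilpotent_add1_unit (M0 x).
(* [M] follows the convention of [Jac], with gradients as rows, hence the transpose against ['J]. *)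
have JF x : 'J F x = (1%:M + M x)^T.
  rewrite linearD /= trmx1 linearZ /= trmxK.
  apply: jacobian_eq => // v; rewrite (@deriveD _ _ _ id (lambda^-1 *: H)).
  - rewrite derive_id deriveZ; last exact: diff_derivable.
    by rewrite deriveEjacobian // mulmxDr mulmx1 -scalemxAr.
  - exact: derivable_id.
  - exact/derivableZ/diff_derivable.
have uJF x : 'J F x \in unitmx by rewrite JF unitmx_tr.
have Fsurj x v : exists u, 'd F x u = v.
  exists (v *m invmx ('J F x)).
  by rewrite -deriveE // deriveEjacobian // mulmxKV.
have cG := inverse_continuous dF Fsurj GK KG.
have dG y := (inverse_diff (dF (G y)) (uJF (G y)) (cG y) KG).1.
have JG y := (inverse_diff (dF (G y)) (uJF (G y)) (cG y) KG).2.
(* In this form the factor [lambda^-1] from the chain rule cancels against the outer [lambda]. *)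
have HtildeE : Htilde = lambda *: (G \o ( *:%R lambda^-1)) - id.
  apply/funext => x; rewrite !fctE /= /Htilde /Hbar scalerBr scalerA mulfV //.
  by rewrite scale1r.
have dGs x : differentiable (G \o ( *:%R lambda^-1)) x by exact: differentiable_comp.
have dHt x : differentiable Htilde x.
  by rewrite HtildeE; apply: differentiableB => //; exact: differentiableZ.
have JHt x : Jac Htilde x = invmx (1%:M + M (G (lambda^-1 *: x))) - 1%:M.
  rewrite /Jac -[RHS]trmxK; congr trmx; apply: jacobian_eq => // v.
  rewrite HtildeE deriveB; [|exact/derivableZ/diff_derivable|exact: derivable_id].
  rewrite deriveZ ?derive_id; last exact: diff_derivable.
  rewrite deriveE // diff_comp //= -deriveE // deriveEjacobian //.
  rewrite diff_val -scalemxAl scalerA mulfV // scale1r JG JF.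
  by rewrite linearB /= trmx1 trmx_inv mulmxBr mulmx1.
split.
- have FE x : Flambda x = lambda *: F x.
    by rewrite /Flambda /F scalerDr scalerA mulfV // scale1r.
  have FiE x : Flambda_inv x = G (lambda^-1 *: x).
    rewrite /Flambda_inv /Htilde /Hbar scalerDr scalerA mulVf // scale1r.
    by rewrite addrC subrK.
  split=> x.
    by rewrite FiE FE scalerA mulVf // scale1r; exact: GK.
  by rewrite FE FiE KG scalerA mulfV // scale1r.
- exact: dHt.
- by exists d => x; rewrite JHt inv_add1_sub1_nilpotent.
- move=> indep c c0; apply: indep => x.
  (* At this point the argument of [M] is [G (F x) = x], so every [x] is reached; multiplying by
     [1 + M x] on the right leaves [- (c *m M x) = 0]. *)
  have := c0 (lambda *: F x); rewrite JHt scalerA mulVf // scale1r GK.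
  move=> /(congr1 (mulmx^~ (1%:M + M x))); rewrite -mulmxA inv_add1_sub1_mul //.
  rewrite mul0mx mulmxN /M -scalemxAr => /eqP.
  by rewrite oppr_eq0 scaler_eq0 invr_eq0 (negPf lambda_neq0) => /eqP.
Qed.
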